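(* Let $k\in\mathbb{N}$ (a positive integer) and let $w$ be a unitary in $\mathcal{F}_n^k$. For $i,j=1,\ldots,n$ let $E_{ij}:\mathcal{F}_n^k\to\mathcal{F}_n^{k-1}$ be the linear maps determined by the condition that $a=\sum_{i,j=1}^n E_{ij}(a)\,\varphi^{k-1}(S_iS_j^* )$ for all $a\in\mathcal{F}_n^k$. Define inductively an increasing sequence of unital selfadjoint subspaces $\mathfrak{S}_r$ of $\mathcal{F}_n^{k-1}$ by $\mathfrak{S}_0=\mathbb{C}1$ and \[ \begin{aligned} \mathfrak{S}_1 &= \operatorname{span}\{E_{jj}(wxw^* ): x\in\mathcal{D}_n^1,\ j=1,\ldots,n\},\\ \widetilde{\mathfrak{S}}_{r+1} &= \operatorname{span}\{E_{jj}(w\varphi(x)w^* ): x\in\mathfrak{S}_r,\ j=1,\ldots,n\},\\ \mathfrak{S}_{r+1} &= \mathfrak{S}_r+\widetilde{\mathfrak{S}}_{r+1}\qquad (r\ge 1). \end{aligned} \] Let $R$ be the smallest positive integer such that $\mathfrak{S}_R=\mathfrak{S}_{R-1}$. Then $\lambda_w(\mathcal{D}_n)\subseteq\mathcal{D}_n$ if and only if $\lambda_w(\mathcal{D}_n^R)\subseteq\mathcal{D}_n$.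
   Context: Let $n\ge 2$ be an integer and let $\mathcal{O}_n$ be the Cuntz algebra, generated by isometries $S_1,\ldots,S_n$ with $\sum_{i=1}^n S_iS_i^*=I$. For a multi-index $\alpha=(\alpha_1,\ldots,\alpha_k)\in W_n^k:=\{1,\ldots,n\}^k$ put $S_\alpha=S_{\alpha_1}\cdots S_{\alpha_k}$ (with $S_\alpha=I$ for the empty word). $\mathcal{F}_n^k$ is the span of $S_\alpha S_\beta^*$ with $\alpha,\beta\in W_n^k$ (isomorphic to $M_{n^k}(\mathbb{C})$; $\mathcal{F}_n^0=\mathbb{C}I$). $\mathcal{D}_n$ is the $C^*$-subalgebra of $\mathcal{O}_n$ generated by all projections $S_\alpha S_\alpha^*$ over all multi-indices $\alpha$, and $\mathcal{D}_n^k=\mathcal{D}_n\cap\mathcal{F}_n^k$. The canonical shift is $\varphi(x)=\sum_{i=1}^n S_ixS_i^*$, with $\varphi^0=\mathrm{id}$. For a unitary $w\in\mathcal{O}_n$, $\lambda_w$ is the unital $*$-endomorphism of $\mathcal{O}_n$ determined by $\lambda_w(S_i)=wS_i$, $i=1,\ldots,n$. *)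

(* Defs.v *)
From HB Require Import structures.
From mathcomp Require Import all_boot all_order all_algebra.
From mathcomp Require Import complex.
From mathcomp Require Import all_classical all_reals all_analysis.

Set Implicit Arguments.
Unset Strict Implicit.
Unset Printing Implicit Defensive.

Import Order.TTheory GRing.Theory Num.Theory.
Import numFieldNormedType.Exports.

Local Open Scope classical_set_scope.
Local Open Scope ring_scope.

HB.mixin Record isStarNormedAlgebra (R : realType) A & GRing.Algebra R[i] A := {
  star : A -> A;
  starK : involutive star;
  starD : {morph star : x y / x + y};
  starZ : forall (c : R[i]) (x : A), star (c *: x) = c^* *: star x;
  starM : forall x y : A, star (x * y) = star y * star x;
  cnorm : A -> R;
  cnormD : forall x y : A, cnorm (x + y) <= cnorm x + cnorm y;
  cnormZ : forall (c : R[i]) (x : A), cnorm (c *: x) = Normc.normc c * cnorm x;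
  cnorm0_eq0 : forall x : A, cnorm x = 0 -> x = 0;
  cnormM : forall x y : A, cnorm (x * y) <= cnorm x * cnorm y;
  cstar_identity : forall x : A, cnorm (star x * x) = cnorm x ^+ 2
}.

#[short(type="starNormedAlgType")]
HB.structure Definition StarNormedAlgebra (R : realType) :=
  {A of GRing.Algebra R[i] A & isStarNormedAlgebra R A}.

(* Hierarchy-Builder does not allow a join of Num.NormedZmodule with the ring
   structures below Num.NumDomain, so the norm topology is put on an alias. *)
Definition normed_space (R : realType) (A : starNormedAlgType R) : Type := A.

Section NormedSpace.
Context (R : realType) (A : starNormedAlgType R).

Let V := normed_space A.
HB.instance Definition _ := GRing.Lmodule.copy V A.

Let nrm (x : V) : R[i] := (cnorm (x : A))%:C%C.

Let nrmD (x y : V) : nrm (x + y) <= nrm x + nrm y.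
Proof. by rewrite /nrm -rmorphD lecR; exact: cnormD. Qed.

Let nrmZ (c : R[i]) (x : V) : nrm (c *: x) = `|c| * nrm x.
Proof.
by rewrite /nrm normc_def -rmorphM; congr (_ %:C%C); case: c => a b; exact: cnormZ. Qed.

Let nrm0_eq0 (x : V) : nrm x = 0 -> x = 0.
Proof. by move=> /eqP; rewrite eq_complex /= => /andP[/eqP/cnorm0_eq0]. Qed.

HB.instance Definition _ := Lmodule_isNormed.Build R[i] V nrmD nrmZ nrm0_eq0.

End NormedSpace.

HB.mixin Record isCStarAlgebra (R : realType) A & StarNormedAlgebra R A := {
  cstar_complete : forall F : set_system (normed_space A),
    ProperFilter F -> cauchy F -> cvg F
}.

(* Unital nonzero complex C*-algebras; 1 != 0 comes from GRing.Algebra. *)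
#[short(type="cstarAlgType")]
HB.structure Definition CStarAlgebra (R : realType) :=
  {A of StarNormedAlgebra R A & isCStarAlgebra R A}.

HB.instance Definition _ (R : realType) (A : cstarAlgType R) :=
  Uniform_isComplete.Build (normed_space A) (@cstar_complete R A).

Section CStarAlgebraTheory.
Context {R : realType} {A : cstarAlgType R}.

Definition lspan (X : set A) : set A :=
  [set x | exists m (c : 'I_m -> R[i]) (v : 'I_m -> A),
     (forall l, X (v l)) /\ x = \sum_(l < m) c l *: v l].

Definition addset (U V : set A) : set A :=
  [set x | exists2 u, U u & exists2 v, V v & x = u + v].

Definition cstar_subalgebra (B : set A) : Prop :=
  [/\ closed (B : set (normed_space A)), B 0,
      forall (c : R[i]) x y, B x -> B y -> B (c *: x + y),
      forall x y, B x -> B y -> B (x * y) &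
      forall x, B x -> B (star x)].

Definition cstar_generated (X : set A) : set A := smallest cstar_subalgebra X.

Definition isometry_elt (v : A) : Prop := star v * v = 1.

Definition unitary_elt (u : A) : Prop := star u * u = 1 /\ u * star u = 1.

Definition star_morphism (f : A -> A) : Prop :=
  forall x, f (star x) = star (f x).

End CStarAlgebraTheory.

Section Cuntz.
Context {R : realType} {A : cstarAlgType R} {n : nat}.
Implicit Types (S : 'I_n -> A) (w : A) (E : 'I_n -> 'I_n -> A -> A).

(* (A, S) is the Cuntz algebra O_n with its canonical generators; by Cuntz's
   uniqueness theorem these conditions determine it up to isomorphism, for
   2 <= n. *)
Definition cuntz_algebra S : Prop :=
  [/\ forall i, isometry_elt (S i),
      \sum_(i < n) S i * star (S i) = 1 &
      cstar_generated (range S) = setT].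

Definition word S k (a : k.-tuple 'I_n) : A := \prod_(i <- a) S i.

Definition Fn S k : set A :=
  lspan [set x | exists a b : k.-tuple 'I_n, x = word S a * star (word S b)].

Definition Dn S : set A :=
  cstar_generated
    [set x | exists k (a : k.-tuple 'I_n), x = word S a * star (word S a)].

Definition Dnk S k : set A := Dn S `&` Fn S k.

Definition cuntz_shift S (x : A) : A := \sum_(i < n) S i * x * star (S i).

(* lam is the endomorphism lambda_w. *)
Definition cuntz_endomorphism S w (lam : {lrmorphism A -> A}) : Prop :=
  star_morphism lam /\ forall i, lam (S i) = w * S i.

(* The E i j are total functions on A; only their restrictions to F_n^k are
   constrained, and those are uniquely determined. *)
Definition coefficient_maps S k E : Prop :=
  [/\ forall i j x, Fn S k x -> Fn S k.-1 (E i j x),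
      forall i j (c : R[i]) x y, Fn S k x -> Fn S k y ->
        E i j (c *: x + y) = c *: E i j x + E i j y &
      forall x, Fn S k x ->
        x = \sum_(i < n) \sum_(j < n)
              E i j x * iter k.-1 (cuntz_shift S) (S i * star (S j))].

Fixpoint frakS S w E (r : nat) : set A :=
  match r with
  | 0 => lspan [set 1]
  | 1 => lspan [set y | exists j, exists2 x, Dnk S 1 x &
                          y = E j j (w * x * star w)]
  | (_.+1 as r').+1 =>
      addset (frakS S w E r')
        (lspan [set y | exists j, exists2 x, frakS S w E r' x &
                          y = E j j (w * cuntz_shift S x * star w)])
  end.

Definition stabilization_index S w E (r : nat) : Prop :=
  [/\ (0 < r)%N, frakS S w E r = frakS S w E r.-1 &
      forall s, (0 < s)%N -> frakS S w E s = frakS S w E s.-1 -> (r <= s)%N].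

End Cuntz.

(* Main.v *)
(* Put P_j = S_j S_j^* and Phi(x) = w phi(x) w^*, so that, for x in D_n^1,
   lambda_w(phi^t(x)) = Phi^t(y) with y = w x w^*.  If y in F_n^k is
   diagonal, then y = sum_j E_jj(y) phi^(k-1)(P_j), and since w commutes with
   phi^k(O_n),
     Phi^s(y) = sum_j Phi^s(E_jj(y)) phi^(k-1+s)(P_j),
   which is diagonal iff every Phi^s(E_jj(y)) is.  Applied to y = w x w^* and to
   y = Phi(z), z in S_r, this shows that lambda_w(D_n^R) in D_n forces Phi to map
   S_(R-1) into D_n; once the spaces S_r are stationary, the same equivalence
   propagates this to all Phi^t, i.e. to all lambda_w(phi^t(P_j)).

   Two C*-algebraic facts are derived from the norm axioms alone, without
   spectral theory: *-endomorphisms are bounded (a self-adjoint x with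
   |x| <= 1/2 is the real part of a unitary x + i sqrt(1 - x^2)), and projections
   summing to 1 are orthogonal (a unit e is an extreme point of the unit ball). *)
Require Import Defs.
From mathcomp Require Import all_boot all_order all_algebra.
From mathcomp Require Import complex.
From mathcomp Require Import all_classical all_reals all_analysis.
From mathcomp Require Import ring lra.
Import Order.TTheory GRing.Theory Num.Theory.
Import numFieldNormedType.Exports.

Local Open Scope classical_set_scope.
Local Open Scope ring_scope.

(** * Norm, adjoint and convergence in a C*-algebra *)

Section CStarNorm.
Context {R : realType} {A : cstarAlgType R}.
Implicit Types (x y z : A) (f : A -> A).

Lemma norm_normed_space (x : normed_space A) : `|x| = (cnorm (x : A))%:C%C.
Proof. by []. Qed.

Lemma cnorm0 : cnorm (0 : A) = 0.
Proof. by rewrite -(scale0r (0 : A)) cnormZ Normc.normc0 mul0r. Qed.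

Lemma cnormN x : cnorm (- x) = cnorm x.
Proof. by rewrite -scaleN1r cnormZ normcN Normc.normc1 mul1r. Qed.

Lemma cnorm_ge0 x : 0 <= cnorm x.
Proof. by have := cnormD x (- x); rewrite subrr cnorm0 cnormN; lra. Qed.

Lemma cnormB x y : cnorm (x - y) <= cnorm x + cnorm y.
Proof. by rewrite -[cnorm y]cnormN; exact: cnormD. Qed.

Lemma cnorm_distC x y : cnorm (x - y) = cnorm (y - x).
Proof. by rewrite -opprB cnormN. Qed.

Lemma normc_real (a : R) : Normc.normc a%:C%C = `|a|.
Proof. by rewrite /= expr0n addr0 sqrtr_sqr. Qed.

(** Carries identities over to a limit: an error below a fixed multiple of every positive [e] is
    zero. *)
Lemma cnorm_small_eq0 x (C : R) :
  (forall e, 0 < e -> cnorm x <= C * e) -> x = 0.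
Proof.
move=> h; apply: cnorm0_eq0; apply/eqP; rewrite eq_le cnorm_ge0 andbT.
rewrite leNgt; apply/negP => x0.
have [C0|C0] := leP C 0.
  by have := h 1 ltr01; lra.
have := h (cnorm x / (2 * C)); rewrite divr_gt0 ?mulr_gt0// => /(_ isT).
have -> : C * (cnorm x / (2 * C)) = cnorm x / 2 by field; rewrite gt_eqF.
lra.
Qed.

Lemma cnorm_star x : cnorm (star x) = cnorm x.
Proof.
have le y : cnorm y <= cnorm (star y).
  have [->|y0] := eqVneq (cnorm y) 0; first exact: cnorm_ge0.
  have yp : 0 < cnorm y by rewrite lt_def y0 cnorm_ge0.
  rewrite -(ler_pM2r yp) -expr2 -cstar_identity; exact: cnormM.
apply/eqP; rewrite eq_le le andbT.
by rewrite -{2}[x]starK le.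
Qed.

Lemma star0 : star (0 : A) = 0.
Proof. by rewrite -(scale0r (0 : A)) starZ rmorph0 !scale0r. Qed.

Lemma starN x : star (- x) = - star x.
Proof. by apply/eqP; rewrite -addr_eq0 -starD addNr star0. Qed.

Lemma starB x y : star (x - y) = star x - star y.
Proof. by rewrite starD starN. Qed.

Lemma star1 : star (1 : A) = 1.
Proof. by rewrite -[LHS]mul1r -{1}[1]starK -starM mul1r starK. Qed.

Lemma starZr (a : R) x : star (a%:C%C *: x) = a%:C%C *: star x.
Proof. by rewrite starZ conj_Creal//; apply/complex_realP; exists a. Qed.

Lemma closed_preimage f (C : R) (B : set A) :
    {morph f : x y / x - y} -> (forall x, cnorm (f x) <= C * cnorm x) ->
    closed (B : set (normed_space A)) ->
  closed (f @^-1` B : set (normed_space A)).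
Proof.
move=> fB fC; pose g : normed_space A -> normed_space A := f.
suff /continuous_closedP/(_ B) : continuous g by [].
move=> x; apply/(@cvgrPdist_lt _ _ _ (nbhs x) (nbhs_filter x) g) => e e0.
(* [C] may be zero or negative, hence the divisor [|C| + 1]. *)
have C1 : 0 < `|C| + 1 by rewrite ltr_wpDl.
have e'0 : 0 < e / (`|C| + 1)%:C%C by rewrite divr_gt0// ltcR.
near=> t.
have -> : g x - g t = g (x - t) by rewrite /g fB.
have : `|x - t| < e / (`|C| + 1)%:C%C.
  by near: t; apply: filterS (nbhsx_ballx x _ e'0) => t; rewrite -ball_normE.
rewrite ltr_pdivlMr ?ltcR// => /le_lt_trans; apply.
rewrite !norm_normed_space -rmorphM lecR (le_trans (fC _))// mulrC ler_wpM2l ?cnorm_ge0//.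
by rewrite (le_trans (ler_norm C))// lerDl.
Unshelve. all: by end_near. Qed.

Lemma closed_eq0 f (C : R) :
    {morph f : x y / x - y} -> (forall x, cnorm (f x) <= C * cnorm x) ->
  closed ([set x | f x = 0] : set (normed_space A)).
Proof.
move=> fB fC; apply: (@closed_preimage f C [set 0]) => //.
apply: accessible_closed_set1; apply: hausdorff_accessible; exact: norm_hausdorff.
Qed.

(** Completeness enters here, in terms of real estimates; it supplies the fixed point in
    [sqrt_one_minus_sqr]. *)
Lemma geometric_cauchy_cvg (u : nat -> A) :
    (forall m, cnorm (u m.+1 - u m) <= 2^-1 ^+ m) ->
  exists l, forall e, 0 < e -> exists N,
    forall m, (N <= m)%N -> cnorm (l - u m) <= e.
Proof.
move=> hu.
(* The bound is the exact sum of the geometric series from m to m + p - 1; keeping the subtracted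
   term makes the induction close. *)
have dist m p : cnorm (u (m + p)%N - u m) <= 2 * 2^-1 ^+ m - 2 * 2^-1 ^+ (m + p).
  elim: p => [|p IH]; first by rewrite addn0 subrr cnorm0 subrr.
  rewrite addnS -[u _ - u m](subrKA (u (m + p)%N)).
  apply: (le_trans (cnormD _ _)); have := hu (m + p)%N; rewrite exprS; lra.
have small (e : R) : 0 < e -> exists N, 2 * 2^-1 ^+ N <= e.
  move=> e0; have := @cvg_expr R 2^-1; rewrite ger0_norm ?invr_ge0// => /(_ _).
  rewrite invf_lt1// ltr1n => /(_ isT)/cvgrPdist_lt/(_ (e / 2)).
  rewrite divr_gt0// => /(_ isT)[N _ /(_ N (leqnn N))].
  rewrite sub0r normrN ger0_norm ?exprn_ge0 ?invr_ge0// => h; exists N; lra.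
have dist' (N : nat) : forall m p, (N <= m)%N -> (N <= p)%N ->
    cnorm (u m - u p) <= 2 * 2^-1 ^+ N.
  move=> m p; wlog mp : m p / (p <= m)%N.
    move=> wl Nm Np; case/orP: (leq_total p m) => h; first exact: wl.
    by rewrite cnorm_distC; apply: wl.
  move=> Nm Np; rewrite -(subnKC mp); apply: (le_trans (dist _ _)).
  rewrite (@le_trans _ _ (2 * 2^-1 ^+ p))// ?gerBl ?mulr_ge0 ?exprn_ge0 ?invr_ge0//.
  by rewrite ler_wpM2l// ler_wiXn2l ?invr_ge0// invf_le1 ?ltr0n ?ler1n.
pose v : nat -> normed_space A := u.
have cv : cvg (v @ \oo).
  apply: cauchy_cvg; apply/cauchy_ballP => e e0.
  (* Radii are complex numbers here; positivity forces [e] to be real. *)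
  have [N hN] : exists N, (2 * 2^-1 ^+ N)%:C%C < e.
    move: e e0 => [a b]; rewrite ltcE/= => /andP[/eqP-> a0].
    have [|N hN] := small (a / 2); first by rewrite divr_gt0.
    exists N; rewrite ltcE/= eqxx/=; lra.
  exists (v @` [set m | (N <= m)%N], v @` [set m | (N <= m)%N]).
    by split; exists N => // m Nm; exists m.
  move=> [_ _] [/= [m Nm <-] [p Np <-]]; rewrite -ball_normE /ball_/= norm_normed_space.
  by apply: le_lt_trans hN; rewrite lecR; exact: dist'.
exists (lim (v @ \oo)) => e e0; have [N hN] := small (e / 2) (divr_gt0 e0 (ltr0Sn _ _)).
exists N => m Nm.
have /cvgrPdist_lt/(_ (e / 2)%:C%C) := cv; rewrite ltcR divr_gt0// => /(_ isT)[M _ hM].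
have := hM (maxn M N) (leq_maxl _ _); rewrite norm_normed_space ltcR => h.
have h' := dist' N (maxn M N) m (leq_maxr _ _) Nm.
rewrite -(subrKA (u (maxn M N))).
by apply: (le_trans (cnormD _ _)); move: h h'; rewrite /v => h h'; lra.
Qed.

End CStarNorm.

(** * Square roots, unitaries and boundedness of *-endomorphisms *)

Section StarMorphism.
Context {R : realType} {A : cstarAlgType R}.
Implicit Types x y z : A.

Lemma cnorm_one : cnorm (1 : A) = 1.
Proof.
have := cstar_identity (1 : A); rewrite star1 mulr1 expr2 => /eqP.
rewrite eq_sym -subr_eq0 -{3}[cnorm _]mulr1 -mulrBr mulf_eq0.
by case/orP => [/eqP/cnorm0_eq0/eqP|]; rewrite ?oner_eq0// subr_eq0 => /eqP.
Qed.

Lemma cnormZr (a : R) x : cnorm (a%:C%C *: x) = `|a| * cnorm x.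
Proof. by rewrite cnormZ normc_real. Qed.

Lemma scale_half x : 2^-1%:C%C *: x + 2^-1%:C%C *: x = x.
Proof.
have h : 2^-1 + 2^-1 = 1 :> R by field.
by rewrite -scalerDl -rmorphD/= h rmorph1 scale1r.
Qed.

(* The root is 1 - l, where l is the fixed point of the contraction
   z |-> (x ^ 2 + z ^ 2) / 2 of the ball of radius 1 / 2. *)
Lemma sqrt_one_minus_sqr x : star x = x -> cnorm x <= 2^-1 ->
  exists y, [/\ star y = y, x * y = y * x & x * x + y * y = 1].
Proof.
move=> xs x2; pose T z := 2^-1%:C%C *: (x * x + z * z).
(* Write z^2 - t^2 as z (z - t) + (z - t) t, valid without commutation. On the ball of radius 1/2
   this gives the contraction constant 1/2. *)
have TB z t : cnorm (T z - T t) <= 2^-1 * ((cnorm z + cnorm t) * cnorm (z - t)).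
  rewrite /T -scalerBr cnormZr ger0_norm ?invr_ge0// ler_wpM2l ?invr_ge0//.
  have -> : x * x + z * z - (x * x + t * t) = z * (z - t) + (z - t) * t.
    by rewrite opprD addrACA subrr add0r mulrBr mulrBl addrA subrK.
  rewrite (le_trans (cnormD _ _))// [leRHS]mulrDl lerD// ?cnormM//.
  by rewrite mulrC cnormM.
pose u m := iter m T 0.
have uP m : [/\ star (u m) = u m, x * u m = u m * x & cnorm (u m) <= 2^-1].
  elim: m => [|m [us ux u2]].
    by rewrite /u /= star0 mulr0 mul0r cnorm0 invr_ge0.
  split; rewrite /u iterS -/(u m).
  - by rewrite /T starZr starD !starM us xs.
  - rewrite /T -scalerAr -scalerAl mulrDr mulrDl !mulrA ux.
    by rewrite -[u m * x * u m]mulrA ux mulrA.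
  rewrite /T cnormZr ger0_norm ?invr_ge0//.
  have := cnormD (x * x) (u m * u m).
  have := ler_pM (cnorm_ge0 _) (cnorm_ge0 _) x2 x2.
  have := ler_pM (cnorm_ge0 _) (cnorm_ge0 _) u2 u2.
  have := cnormM x x; have := cnormM (u m) (u m); lra.
have [|l hl] := @geometric_cauchy_cvg _ _ u.
  elim=> [|m IH].
    have [_ _] := uP 1%N; rewrite [u 0%N]/= subr0 expr0 => h.
    by rewrite (le_trans h)// invf_le1 ?ltr0n ?ler1n.
  rewrite /u iterS [iter m.+1 T 0 in X in _ - X]iterS -/(u m) -/(u m.+1).
  apply: (le_trans (TB _ _)); rewrite exprS ler_wpM2l ?invr_ge0//.
  apply: le_trans IH; rewrite ler_piMl ?cnorm_ge0//.
  have [_ _] := uP m; have [_ _] := uP m.+1; lra.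
have ls : star l = l.
  apply/eqP; rewrite -subr_eq0; apply/eqP; apply: (@cnorm_small_eq0 _ _ _ 2).
  move=> e /hl [N /(_ N (leqnn N)) le]; have [us _ _] := uP N.
  rewrite -(subrKA (u N)) -[X in star l - X]us -starB.
  rewrite (le_trans (cnormD _ _))// cnorm_star [cnorm (u N - l)]cnorm_distC; lra.
have lx : x * l = l * x.
  apply/eqP; rewrite -subr_eq0; apply/eqP.
  apply: (@cnorm_small_eq0 _ _ _ (2 * cnorm x)).
  move=> e /hl [N /(_ N (leqnn N)) le]; have [_ ux _] := uP N.
  rewrite -(subrKA (x * u N)) -mulrBr ux -mulrBl.
  rewrite (le_trans (cnormD _ _))//.
  have := cnormM x (l - u N); have := cnormM (u N - l) x.
  rewrite [cnorm (u N - l)]cnorm_distC.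
  have := ler_wpM2l (cnorm_ge0 x) le; lra.
(* Both sides are compared with u_(N+1) = T u_N; the first error is at most e, and [TB] bounds the
   second. *)
have lT : l = T l.
  apply/eqP; rewrite -subr_eq0; apply/eqP.
  apply: (@cnorm_small_eq0 _ _ _ (1 + 2^-1 * (2^-1 + cnorm l))).
  move=> e e0; have [N hN] := hl e e0.
  have le := hN N (leqnn N); have le1 := hN N.+1 (leqnSn N).
  rewrite -(subrKA (u N.+1)) (le_trans (cnormD _ _))//.
  have [_ _ u2] := uP N; have := TB (u N) l.
  rewrite -[T (u N)]/(u N.+1) [cnorm (u N - l)]cnorm_distC.
  have : (cnorm (u N) + cnorm l) * cnorm (l - u N) <= (2^-1 + cnorm l) * e.
    by apply: ler_pM; rewrite ?addr_ge0 ?cnorm_ge0// lerD2r.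
  lra.
have ll : x * x + l * l = l + l.
  by rewrite {3 4}lT /T -scalerDr scalerDr scale_half.
(* Since x^2 + l^2 = 2 l, the square of 1 - l is 1 - x^2. *)
exists (1 - l); split.
- by rewrite starB star1 ls.
- by rewrite mulrBr mulrBl mulr1 mul1r lx.
rewrite mulrBl mul1r mulrBr mulr1 opprB.
have -> : l * l = l + l - x * x by rewrite -ll addrAC subrr add0r.
by rewrite [l + l - _ - _]addrAC addrK subrKA addrC subrK.
Qed.

Lemma star_morphism_bounded (f : {lrmorphism A -> A}) : star_morphism f ->
  forall x, cnorm (f x) <= 2 * cnorm x.
Proof.
move=> fs.
have unit_ball x : star x = x -> cnorm x <= 2^-1 -> cnorm (f x) <= 1.
  (* Here u is the image of the unitary x + i y, so it has norm 1, and 2 f(x) is the sum of u and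
     its adjoint. *)
  move=> xs x2; have [y [ys xy xy1]] := sqrt_one_minus_sqr x xs x2.
  pose u := f x + 'i *: f y.
  have su : star u = f x - 'i *: f y.
    by rewrite /u starD starZ conjCi scaleNr -!fs xs ys.
  have u1 : cnorm u = 1.
    have /eqP : cnorm u ^+ 2 = 1.
      rewrite -cstar_identity su /u mulrDr !mulrBl -!scalerAl -!scalerAr.
      rewrite -!rmorphM/= scalerA -[_ * 'i]expr2 sqrCi xy scaleN1r opprK.
      by rewrite addrA subrK -rmorphD xy1 rmorph1 cnorm_one.
    by rewrite -[1 in X in X -> _](expr1n _ 2) eqrXn2 ?cnorm_ge0// => /eqP.
  have : cnorm (f x + f x) <= 1 + 1.
    rewrite -{1}u1 -[X in _ <= _ + X]u1 -[X in _ <= _ + X]cnorm_star.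
    by rewrite (le_trans _ (cnormD _ _))// su /u addrACA subrr addr0.
  have -> : f x + f x = 2%:C%C *: f x.
    by rewrite -[2]/(1 + 1) rmorphD scalerDl scale1r.
  rewrite cnormZr ger0_norm//; lra.
have sa x : star x = x -> cnorm (f x) <= 2 * cnorm x.
  move=> xs; have [x0|x0] := eqVneq (cnorm x) 0.
    by rewrite (cnorm0_eq0 _ x0) rmorph0 cnorm0 mulr0.
  have xp : 0 < cnorm x by rewrite lt_def x0 cnorm_ge0.
  have c0 : 0 < (2 * cnorm x)^-1 by rewrite invr_gt0 mulr_gt0.
  have : (2 * cnorm x)^-1 * cnorm (f x) <= 1.
    have := unit_ball ((2 * cnorm x)^-1%:C%C *: x).
    rewrite starZr xs cnormZr linearZ/= cnormZr ger0_norm ?(ltW c0)//.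
    by apply => //; rewrite invfM mulfVK.
  by rewrite ler_pdivrMl ?mulr1// mulr_gt0.
(* For general x, pass to the self-adjoint [star x * x]: |f(x)|^2 <= 2 |x|^2 <= (2 |x|)^2. *)
move=> x; rewrite -ler_sqr ?nnegrE ?mulr_ge0 ?cnorm_ge0// -cstar_identity.
rewrite -fs -rmorphM/= (le_trans (sa _ _))//; first by rewrite starM starK.
by rewrite cstar_identity exprMn ler_wpM2r ?sqr_ge0// expr2 ler_peMr// ler1n.
Qed.

End StarMorphism.

(** * Extremality of units and orthogonality of projections *)

Section Projections.
Context {R : realType} {A : cstarAlgType R}.
Implicit Types (e f u x y : A).

Lemma cnorm_sum I (s : seq I) (P : pred I) (F : I -> A) :
  cnorm (\sum_(i <- s | P i) F i) <= \sum_(i <- s | P i) cnorm (F i).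
Proof.
elim/big_ind2: _ => [|x a y b xa yb|//]; first by rewrite cnorm0.
by rewrite (le_trans (cnormD _ _))// lerD.
Qed.

Lemma cnorm_cube x (c : R) : cnorm x <= c -> cnorm (x * x * x) <= c ^+ 3.
Proof.
move=> xc; have x0 := cnorm_ge0 x.
rewrite (le_trans (cnormM _ _))// exprSr ler_pM ?cnorm_ge0//.
by rewrite (le_trans (cnormM _ _))// expr2 ler_pM ?cnorm_ge0.
Qed.

(* Uses [e + u^2 = ((e + u)^2 + (e - u)^2) / 2] and
   [|e + i u|^2 = |e + u^2|]. *)
Lemma cnorm_corner_imaginary e u (c : R[i]) :
    star e = e -> star u = u -> e * e = e -> e * u = u -> u * e = u ->
    cnorm (e + u) <= 1 -> cnorm (e - u) <= 1 -> c * c = -1 -> c^* = - c ->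
  cnorm (e + c *: u) <= 1.
Proof.
move=> es us ee eu ue n1 n2 cc cJ.
rewrite -(@ler_pXn2r _ 2)// ?nnegrE ?cnorm_ge0//.
rewrite -cstar_identity starD starZ es us cJ expr1n.
have -> : (e + - c *: u) * (e + c *: u) = e + u * u.
  rewrite mulrDr !mulrDl -!scalerAl -!scalerAr ee ue eu scalerA mulNr cc opprK scale1r.
  by rewrite addrA scaleNr subrK.
have h : cnorm ((e + u * u) + (e + u * u)) <= 1 + 1.
  have -> : (e + u * u) + (e + u * u) = (e + u) * (e + u) + (e - u) * (e - u).
    have -> : (e + u) * (e + u) = (e + u * u) + (u + u).
      by rewrite mulrDr !mulrDl ee eu ue (AC (2*2) ((1*4)*(2*3))).
    have -> : (e - u) * (e - u) = (e + u * u) - (u + u).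
      by rewrite mulrBr !mulrBl ee eu ue opprB opprD (AC (2*2) ((1*3)*(2*4))).
    by rewrite [RHS]addrACA subrr addr0.
  rewrite (le_trans (cnormD _ _))// lerD// (le_trans (cnormM _ _))//.
    by rewrite mulr_ile1 ?cnorm_ge0.
  by rewrite mulr_ile1 ?cnorm_ge0.
move: h; have -> : e + u * u + (e + u * u) = 2%:C%C *: (e + u * u).
  by rewrite -[2]/(1 + 1) rmorphD scalerDl scale1r.
rewrite cnormZr ger0_norm//; lra.
Qed.

(* [e + 3/2 u] is an average of cubes [(e + z u)^3] with [|e + z u| <= 1],
   the weights of the points z being chosen to kill the u^2 and u^3 terms. *)
Lemma cnorm_corner_expand e u :
    star e = e -> star u = u -> e * e = e -> e * u = u -> u * e = u ->
    cnorm (e + u) <= 1 -> cnorm (e - u) <= 1 ->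
  cnorm (e + (3 / 2)%:C%C *: u) <= 1.
Proof.
move=> es us ee eu ue n1 n2.
pose L (a b c d : R[i]) : A := a *: e + b *: u + c *: (u * u) + d *: (u * u * u).
have LD a b c d a' b' c' d' :
    L a b c d + L a' b' c' d' = L (a + a') (b + b') (c + c') (d + d').
  by rewrite /L addrACA -scalerDl; congr (_ + _);
    rewrite addrACA -scalerDl; congr (_ + _); rewrite addrACA -!scalerDl.
have LZ k a b c d : k *: L a b c d = L (k * a) (k * b) (k * c) (k * d).
  by rewrite /L !scalerDr !scalerA.
have cube (a b : R[i]) : (a *: e + b *: u) * (a *: e + b *: u) * (a *: e + b *: u) =
    L (a ^+ 3) (3 * a ^+ 2 * b) (3 * a * b ^+ 2) (b ^+ 3).
  have -> : (a *: e + b *: u) * (a *: e + b *: u) =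
      (a ^+ 2) *: e + (a * b + b * a) *: u + b ^+ 2 *: (u * u).
    rewrite mulrDr !mulrDl -!scalerAl -!scalerAr !scalerA ee eu ue -!expr2.
    by rewrite scalerDl [b * a]mulrC !addrA.
  rewrite [in LHS]mulrDr ![in LHS]mulrDl -![in LHS]scalerAl -![in LHS]scalerAr.
  rewrite ![in LHS]scalerA ee eu ue -![in LHS]mulrA ue.
  rewrite [LHS](AC (3*3) (1*(2*4)*(3*5)*6)) /= -!scalerDl /L !mulrA.
  by congr (_ *: _ + _ *: _ + _ *: _ + _ *: _); ring.
have n3 (c : R[i]) : c * c = -1 -> c^* = - c -> cnorm (e + c *: u) <= 1.
  exact: cnorm_corner_imaginary.
have conji : ('i : R[i])^* = - 'i by exact: conjCi.
have ii : ('i : R[i]) * 'i = -1 by rewrite -expr2 sqrCi.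
have nii : (- 'i : R[i]) * - 'i = -1 by rewrite mulrNN.
have conjni : (- 'i : R[i])^* = - - 'i by rewrite rmorphN; congr (- _); exact: conjCi.
(* This is the sum of [e + u] and [e + c *: u], that is, twice the point with parameter (1 + c) /
   2. *)
pose z (c : R[i]) := 2 *: e + (1 + c) *: u.
have zn (c : R[i]) : c * c = -1 -> c^* = - c -> cnorm (z c) <= 2.
  move=> cc cJ; have -> : z c = (e + u) + (e + c *: u).
    by rewrite addrACA /z -[2]/(1 + 1) !scalerDl !scale1r.
  by rewrite (le_trans (cnormD _ _))// -[2]/(1 + 1) lerD// n3.
pose v (c : R[i]) := 1 *: e + c *: u.
have vn (c : R[i]) : c * c = -1 -> c^* = - c -> cnorm (v c) <= 1.
  by move=> cc cJ; rewrite /v scale1r n3.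
(* The cubes have norm bounds 1, 8, 8, 1, 1 and weights 4, 1, 1, 2, 2, with total 24, which is also
   the coefficient of e. That of u is 12 + 24 + 0 = 36; those of u^2 and u^3 are 12 + 0 - 12 and 4 -
   4 + 0. *)
have key : 24%:C%C *: (e + (3 / 2)%:C%C *: u) =
  4%:C%C *: (v 1 * v 1 * v 1) + (z 'i * z 'i * z 'i + z (- 'i) * z (- 'i) * z (- 'i))
  + 2%:C%C *: (v 'i * v 'i * v 'i + v (- 'i) * v (- 'i) * v (- 'i)).
  have hL : e + (3 / 2)%:C%C *: u = L 1 (3 / 2)%:C%C 0 0.
    by rewrite /L !scale0r !addr0 scale1r.
  have i2 : ('i : R[i]) ^+ 2 = -1 by exact: sqrCi.
  rewrite hL /z /v !cube !(LD, LZ).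
  have -> : (3 / 2)%:C%C = 3 / 2 :> R[i] by rewrite rmorphM fmorphV !rmorph_nat.
  rewrite !(rmorph_nat (real_complex R)).
  by congr L; [ring|field|ring: i2|ring: i2].
have : cnorm (24%:C%C *: (e + (3 / 2)%:C%C *: u)) <= 24.
  rewrite key.
  have v1 : cnorm (v 1) <= 1 by rewrite /v !scale1r.
  have := cnorm_cube _ _ v1; rewrite expr1n.
  have := cnorm_cube _ _ (zn _ ii conji); have := cnorm_cube _ _ (zn _ nii conjni).
  have := cnorm_cube _ _ (vn _ ii conji); have := cnorm_cube _ _ (vn _ nii conjni).
  rewrite expr1n; set a1 := v 1 * _ * _; set a2 := z 'i * _ * _.
  set a3 := z (- 'i) * _ * _; set a4 := v 'i * _ * _; set a5 := v (- 'i) * _ * _.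
  have := cnormD (4%:C%C *: a1 + (a2 + a3)) (2%:C%C *: (a4 + a5)).
  have := cnormD (4%:C%C *: a1) (a2 + a3); have := cnormD a2 a3.
  rewrite !cnormZr !ger0_norm//; have := cnormD a4 a5; lra.
by rewrite cnormZr ger0_norm//; lra.
Qed.

(* Extremality of the unit e in the ball of the corner [e A e]: by the previous
   lemma, u can be scaled up by 3/2 indefinitely. *)
Lemma corner_eq0 e u :
    star e = e -> star u = u -> e * e = e -> e * u = u -> u * e = u ->
    cnorm (e + u) <= 1 -> cnorm (e - u) <= 1 ->
  u = 0.
Proof.
move=> es us ee eu ue n1 n2.
have grow m : cnorm (e + ((3 / 2) ^+ m)%:C%C *: u) <= 1 /\
              cnorm (e - ((3 / 2) ^+ m)%:C%C *: u) <= 1.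
  elim: m => [|m [IH1 IH2]]; first by rewrite expr0 scale1r.
  set c := ((3 / 2) ^+ m)%:C%C in IH1 IH2.
  have cs : star (c *: u) = c *: u by rewrite starZr us.
  have ec : e * (c *: u) = c *: u by rewrite -scalerAr eu.
  have ce : (c *: u) * e = c *: u by rewrite -scalerAl ue.
  rewrite exprS rmorphM/= -scalerA -/c; split.
    exact: cnorm_corner_expand.
  rewrite -scalerN; apply: cnorm_corner_expand;
    rewrite ?mulrN ?mulNr ?starN ?cs ?ec ?ce//.
  by rewrite opprK.
apply/cnorm0_eq0/eqP; rewrite eq_le cnorm_ge0 andbT leNgt; apply/negP => u0.
(* Bernoulli's inequality: the factors are unbounded, which contradicts [small] for a nonzero u. *)
have bern m : 1 + m%:R / 2 <= (3 / 2) ^+ m :> R.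
  elim: m => [|m IH]; first by rewrite expr0; lra.
  have m0 : 0 <= m%:R :> R by rewrite ler0n.
  by rewrite exprS -natr1; lra.
have small m : (3 / 2) ^+ m * cnorm u <= 1.
  have [h1 h2] := grow m.
  have := cnormB (e + ((3 / 2) ^+ m)%:C%C *: u) (e - ((3 / 2) ^+ m)%:C%C *: u).
  rewrite opprB addrC subrKA -scalerDl -rmorphD cnormZr ger0_norm.
    by rewrite mulrDl; lra.
  by rewrite addr_ge0// exprn_ge0// divr_ge0.
pose m := Num.bound (2 / cnorm u).
have hm : 2 / cnorm u < m%:R by apply: archi_boundP; rewrite divr_ge0// cnorm_ge0.
move: hm; rewrite ltr_pdivrMr// => hm.
have := ler_wpM2r (cnorm_ge0 u) (bern m); have := small m; rewrite mulrDl; lra.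
Qed.

(** With e = p_j, the compressions e p_l e for l other than j sum to 0. The reflections 1 - 2 p_l
    have norm 1, so an average of n terms, each e (1 - 2 p_l) e or e, stays in the unit ball.
    Reflecting for l = i alone, or for all l other than i and j, puts e - (2/n) y and e + (2/n) y
    there, where y = e p_i e. Hence y = 0 by [corner_eq0], and |p_i p_j|^2 = |y|. *)
Lemma sum_one_orthogonal n (p : 'I_n -> A) :
    (forall i, star (p i) = p i) -> (forall i, p i * p i = p i) ->
    \sum_(i < n) p i = 1 ->
  forall i j, i != j -> p i * p j = 0.
Proof.
move=> ps pp p1 i j ij; set e := p j; set f := p i.
have e1 : cnorm e <= 1.
  have [->//|e0] := eqVneq (cnorm e) 0.
  rewrite -(@ler_pM2l _ (cnorm e)) ?lt_def ?e0 ?cnorm_ge0// mulr1.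
  by rewrite -expr2 -cstar_identity ps pp.
have compress (Q : pred 'I_n) :
    cnorm (n%:R%:C%C *: e - 2%:C%C *: \sum_(l < n | Q l) e * p l * e) <= n%:R.
  have -> : n%:R%:C%C *: e - 2%:C%C *: \sum_(l < n | Q l) e * p l * e =
      \sum_(l < n) (if Q l then e * (1 - (p l + p l)) * e else e).
    rewrite [RHS](eq_bigr (fun l =>
      e - (if Q l then 2%:C%C *: (e * p l * e) else 0))); last first.
      move=> l _; case: (Q l); last by rewrite subr0.
      rewrite mulrBr mulrBl mulr1 pp mulrDr mulrDl.
      by rewrite -[2]/(1 + 1) rmorphD scalerDl scale1r.
    rewrite sumrB sumr_const card_ord -big_mkcond/= scaler_sumr; congr (_ - _).
    by rewrite rmorph_nat scaler_nat.
  rewrite (le_trans (cnorm_sum _ _ _ _))//.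
  rewrite -[X in _ <= X%:R]card_ord -sumr_const ler_sum// => l _.
  case: ifP => // _.
  have s1 : cnorm (1 - (p l + p l)) = 1.
    apply/eqP; rewrite -(eqrXn2 (n := 2)) ?cnorm_ge0//; apply/eqP.
    rewrite -cstar_identity starB starD star1 ps mulrBl mul1r mulrBr mulr1.
    by rewrite mulrDl mulrDr pp opprB addrK subrK cnorm_one expr1n.
  rewrite (le_trans (cnormM _ _))// mulr_ile1 ?cnorm_ge0//.
  by rewrite (le_trans (cnormM _ _))// s1 mulr1.
have n0 : 0 < n%:R :> R by rewrite ltr0n; apply: leq_trans (ltn_ord i).
pose y := e * f * e.
have yE : y = - \sum_(l < n | (l != i) && (l != j)) e * p l * e.
  apply/eqP; rewrite -addr_eq0; apply/eqP; apply: (addrI e).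
  have : e * 1 * e = e by rewrite mulr1 pp.
  rewrite -p1 mulr_sumr mulr_suml (bigD1 j)//= -/e !pp (bigD1 i)//= => h.
  by rewrite addr0 -[RHS]h /y; congr (_ + (_ + _)); apply: eq_bigl => l; rewrite andbC.
have ys : star y = y by rewrite /y !starM !ps mulrA.
have ey : e * y = y by rewrite /y !mulrA pp.
have ye : y * e = y by rewrite /y -!mulrA pp.
have c1 : n%:R^-1%:C%C *: (n%:R%:C%C *: e) = e.
  by rewrite scalerA -rmorphM/= mulVf ?gt_eqF// rmorph1 scale1r.
have cB x : cnorm (n%:R%:C%C *: e + x) <= n%:R -> cnorm (e + n%:R^-1%:C%C *: x) <= 1.
  rewrite -{2}c1 -scalerDr cnormZr ger0_norm ?invr_ge0// => h.
  by rewrite ler_pdivrMl// mulr1.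
have y0 : n%:R^-1%:C%C *: (2%:C%C *: y) = 0.
  apply: (@corner_eq0 e); rewrite ?ps ?pp// ?starZr ?ys// -?scalerAr -?scalerAl ?ey ?ye//.
    apply: cB; have := compress [pred l | (l != i) && (l != j)].
    by rewrite -[X in _ - _ *: X]opprK -yE scalerN opprK.
  rewrite -scalerN; apply: cB; have := compress (pred1 i).
  by rewrite big_pred1_eq.
have {}y0 : y = 0.
  move/eqP: y0; rewrite !scaler_eq0 => /orP[|/orP[|/eqP//]].
    by rewrite eq_complex/= eqxx andbT invr_eq0 gt_eqF.
  by rewrite eq_complex/= eqxx andbT gt_eqF.
apply: cnorm0_eq0; apply/eqP; rewrite -sqrf_eq0 -cstar_identity starM !ps.
by rewrite mulrA -[_ * f * f]mulrA pp -/y y0 cnorm0.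
Qed.
End Projections.

(** * Generated C*-subalgebras and commutants *)

Section CStarSubalgebra.
Context {R : realType} {A : cstarAlgType R}.
Implicit Types (B X : set A) (x y : A).

Lemma cstar_generatedP X : cstar_subalgebra (cstar_generated X).
Proof.
split.
- by apply: closed_bigI => B [[]].
- by move=> B [[]].
- move=> c x y Xx Xy B BX; have [[_ _ lB _ _] _] := BX.
  by apply: lB; [exact: Xx|exact: Xy].
- move=> x y Xx Xy B BX; have [[_ _ _ mB _] _] := BX.
  by apply: mB; [exact: Xx|exact: Xy].
- by move=> x Xx B BX; have [[_ _ _ _ sB] _] := BX; apply: sB; exact: Xx.
Qed.

Lemma cstar_generated_min X B : cstar_subalgebra B -> X `<=` B ->
  cstar_generated X `<=` B.
Proof. exact: smallest_sub. Qed.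

Lemma cstar_subalgebra_sum B : cstar_subalgebra B -> forall I (s : seq I) (F : I -> A),
  (forall i, B (F i)) -> B (\sum_(i <- s) F i).
Proof.
move=> [_ B0 Bl _ _] I s F BF; elim/big_ind: _ => // x y Bx By.
by rewrite -[x]scale1r; exact: Bl.
Qed.

Lemma cstar_subalgebraZ B : cstar_subalgebra B -> forall c x, B x -> B (c *: x).
Proof. by move=> [_ B0 Bl _ _] c x Bx; rewrite -[_ *: _]addr0; exact: Bl. Qed.

Lemma commutant_cstar_subalgebra X : (forall x, X x -> X (star x)) ->
  cstar_subalgebra [set y | forall x, X x -> y * x = x * y].
Proof.
move=> Xs; split.
- rewrite [X in closed X](_ : _ = \bigcap_(x in X) [set y | y * x - x * y = 0]).
    apply: closed_bigI => x _.
    apply: (@closed_eq0 _ _ (fun y => y * x - x * y) (2 * cnorm x)) => [y z|y].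
      by rewrite mulrBl mulrBr !opprB [LHS](AC (2*2) ((1*4)*(3*2))).
    have := cnormB (y * x) (x * y); have := cnormM y x; have := cnormM x y; lra.
  apply/seteqP; split=> y /= h x Xx /=; first by rewrite (h x Xx) subrr.
  by have /= /eqP := h x Xx; rewrite subr_eq0 => /eqP.
- by move=> x _; rewrite mulr0 mul0r.
- move=> c y z hy hz x Xx.
  by rewrite mulrDl mulrDr -scalerAl -scalerAr hy// hz.
- by move=> y z hy hz x Xx; rewrite -mulrA hz// mulrA hy// mulrA.
- move=> y hy x Xx; rewrite -[x]starK -!starM hy//; exact: Xs.
Qed.

(** Two passes through a commutant: first a generator against the whole algebra, then the whole
    algebra against itself. *)
Lemma cstar_generated_commutative X :
    (forall x, X x -> X (star x)) -> (forall x y, X x -> X y -> x * y = y * x) ->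
  forall x y, cstar_generated X x -> cstar_generated X y -> x * y = y * x.
Proof.
move=> Xs Xc.
have h1 x : X x -> forall y, cstar_generated X y -> y * x = x * y.
  move=> Xx y /(cstar_generated_min _ _ (commutant_cstar_subalgebra _ Xs)) -> //.
  by move=> z Xz t Xt; apply: Xc.
have Cs x : cstar_generated X x -> cstar_generated X (star x).
  by have [_ _ _ _] := cstar_generatedP X; apply.
move=> x y Xx Xy.
apply: (cstar_generated_min _ _ (commutant_cstar_subalgebra _ Cs) _ x Xx y Xy).
by move=> z Xz t Xt; exact/esym/h1.
Qed.

(** Reduces the invariance of a generated C*-subalgebra to its generators; closedness comes from the
    boundedness of f. *)
Lemma star_morphism_preimage (f : {lrmorphism A -> A}) B :
  star_morphism f -> cstar_subalgebra B -> cstar_subalgebra (f @^-1` B).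
Proof.
move=> fs [Bc B0 Bl Bm Bs]; split => /=.
- apply: (@closed_preimage _ _ f 2) => //; first exact: rmorphB.
  exact: star_morphism_bounded.
- by rewrite rmorph0.
- by move=> c x y /= fx fy; rewrite linearP; exact: Bl.
- by move=> x y /= fx fy; rewrite rmorphM; exact: Bm.
- by move=> x /= fx; rewrite fs; exact: Bs.
Qed.

End CStarSubalgebra.

(** * Linear spans *)

Section LinearSpan.
Context {R : realType} {A : cstarAlgType R}.
Implicit Types (X Y : set A) (x y : A).

Lemma lspan0 X : lspan X 0.
Proof. by exists 0%N, (fun=> 0), (fun=> 0); split; [case|rewrite big_ord0]. Qed.

Lemma lspanD X x y : lspan X x -> lspan X y -> lspan X (x + y).
Proof.
move=> [p1 [c1 [v1 [h1 ->]]]] [p2 [c2 [v2 [h2 ->]]]].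
exists (p1 + p2)%N,
  (fun l => match fintype.split l with inl l => c1 l | inr l => c2 l end),
  (fun l => match fintype.split l with inl l => v1 l | inr l => v2 l end); split.
  by move=> l; case: (fintype.split l).
rewrite big_split_ord; congr (_ + _); apply: eq_bigr => l _.
  by rewrite -[lshift _ l]/(unsplit (inl l)) unsplitK.
by rewrite -[rshift _ l]/(unsplit (inr l)) unsplitK.
Qed.

Lemma lspan_min X Y : Y 0 -> (forall (a : R[i]) x y, Y x -> Y y -> Y (a *: x + y)) ->
  X `<=` Y -> lspan X `<=` Y.
Proof.
move=> Y0 Yl XY _ [m [c [v [hv ->]]]].
by elim/big_rec: _ => [//|l x _ Yx]; apply: Yl => //; exact: XY.
Qed.

Lemma sub_lspan X : X `<=` lspan X.
Proof.
by move=> x Xx; exists 1%N, (fun=> 1), (fun=> x); rewrite big_ord1 scale1r.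
Qed.

End LinearSpan.

(** * Matrix corners and the filtration by the algebras F_n^m *)

Section CuntzCorners.
Context {R : realType} {A : cstarAlgType R} {n : nat} (S : 'I_n -> A).
Hypothesis hS : cuntz_algebra S.
Implicit Types (x y c d : A) (i j : 'I_n).
Local Notation phi := (cuntz_shift S).

Lemma cuntz_sum1 : \sum_(i < n) S i * star (S i) = 1.
Proof. by case: hS. Qed.

Lemma cuntz_isometry i : star (S i) * S i = 1.
Proof. by case: hS => h _ _; exact: h. Qed.

(** The range projections sum to 1, so they are orthogonal; the isometry relations then strip the
    outer factors. *)
Lemma cuntz_orthogonal i j : i != j -> star (S i) * S j = 0.
Proof.
move=> ij.
have h : (S i * star (S i)) * (S j * star (S j)) = 0.
  apply: (@sum_one_orthogonal _ _ n (fun i => S i * star (S i))) => // [l|l|].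
  - by rewrite starM starK.
  - by rewrite mulrA -[_ * _ * S l]mulrA cuntz_isometry mulr1.
  - exact: cuntz_sum1.
have : star (S i) * ((S i * star (S i)) * (S j * star (S j))) * S j = 0.
  by rewrite h mulr0 mul0r.
by rewrite !mulrA cuntz_isometry mul1r -mulrA cuntz_isometry mulr1.
Qed.

Lemma cuntz_relation i j : star (S i) * S j = (i == j)%:R.
Proof.
by have [->|ij] := eqVneq i j; [exact: cuntz_isometry|exact: cuntz_orthogonal].
Qed.

(** The matrix entries of x under the identification of A with M_n(A) given by the S_i. The
    canonical shift becomes x -> diag(x, ..., x). *)
Definition corner i j x := star (S i) * x * S j.

Lemma corner_expand x : x = \sum_i \sum_j S i * corner i j x * star (S j).
Proof.
rewrite -[LHS]mul1r -[LHS]mulr1 -{1}cuntz_sum1 mulr_suml mulr_suml.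
apply: eq_bigr => i _; rewrite -cuntz_sum1 mulr_sumr; apply: eq_bigr => j _.
by rewrite /corner !mulrA.
Qed.

Lemma corner_inj x y : (forall i j, corner i j x = corner i j y) -> x = y.
Proof.
move=> h; rewrite [x]corner_expand [y]corner_expand.
by apply: eq_bigr => i _; apply: eq_bigr => j _; rewrite h.
Qed.

Lemma corner_linear i j (a : R[i]) x y :
  corner i j (a *: x + y) = a *: corner i j x + corner i j y.
Proof. by rewrite /corner mulrDr mulrDl -scalerAr -scalerAl. Qed.

Lemma corner0 i j : corner i j 0 = 0.
Proof. by rewrite /corner mulr0 mul0r. Qed.

Lemma cornerM i j x y : corner i j (x * y) = \sum_l corner i l x * corner l j y.
Proof.
rewrite /corner -{1}[x]mulr1 -cuntz_sum1 mulr_sumr !mulr_suml mulr_sumr mulr_suml.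
by apply: eq_bigr => l _; rewrite !mulrA.
Qed.

Lemma corner_star i j x : corner i j (star x) = star (corner j i x).
Proof. by rewrite /corner !starM starK mulrA. Qed.

Lemma corner1 i j : corner i j 1 = (i == j)%:R.
Proof. by rewrite /corner mulr1 cuntz_relation. Qed.

Lemma corner_unit i j l m x :
  corner i j (S l * x * star (S m)) = ((i == l) && (m == j))%:R * x.
Proof.
rewrite /corner !mulrA cuntz_relation -mulrA cuntz_relation.
by case: (i == l); case: (m == j); rewrite ?mul1r ?mulr1 ?mul0r ?mulr0.
Qed.

Lemma corner_shift i j x : corner i j (phi x) = (i == j)%:R * x.
Proof.
rewrite /corner /cuntz_shift mulr_sumr mulr_suml (bigD1 i)//= big1 => [|l li].
  by rewrite -/(corner i j _) corner_unit eqxx addr0.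
by rewrite -/(corner i j _) corner_unit eq_sym (negbTE li) mul0r.
Qed.

Lemma shift_linear (a : R[i]) x y : phi (a *: x + y) = a *: phi x + phi y.
Proof.
by apply: corner_inj => i j; rewrite corner_linear !corner_shift mulrDr scalerAr.
Qed.

Lemma shift1 : phi 1 = 1.
Proof. by apply: corner_inj => i j; rewrite corner_shift corner1 mulr1. Qed.

Lemma shift0 : phi 0 = 0.
Proof. by apply: corner_inj => i j; rewrite corner_shift corner0 mulr0. Qed.

Lemma shiftM x y : phi (x * y) = phi x * phi y.
Proof.
apply: corner_inj => i j; rewrite corner_shift cornerM (bigD1 i)//= big1 => [|l li].
  by rewrite !corner_shift eqxx mul1r addr0 !mulrA;
    case: (i == j); rewrite ?mulr1 ?mul1r ?mulr0 ?mul0r.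
by rewrite corner_shift eq_sym (negbTE li) !mul0r.
Qed.

Lemma iter_shift1 m : iter m phi 1 = 1.
Proof. by elim: m => // m IH; rewrite iterS IH shift1. Qed.

Lemma iter_shift0 m : iter m phi 0 = 0.
Proof. by elim: m => // m IH; rewrite iterS IH shift0. Qed.

Lemma iter_shiftM m x y : iter m phi (x * y) = iter m phi x * iter m phi y.
Proof. by elim: m => // m IH; rewrite !iterS IH shiftM. Qed.

Lemma iter_shiftD m x y : iter m phi (x + y) = iter m phi x + iter m phi y.
Proof.
elim: m => // m IH.
by rewrite !iterS IH -[X in X + _]scale1r shift_linear scale1r.
Qed.

Lemma iter_shift_sum m I (s : seq I) (F : I -> A) :
  iter m phi (\sum_(i <- s) F i) = \sum_(i <- s) iter m phi (F i).
Proof. by apply: big_morph; [exact: iter_shiftD|exact: iter_shift0]. Qed.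

(* The recursive description of F_n^m: iterated corners are scalars. *)
Fixpoint level m x : Prop :=
  if m is m'.+1 then forall i j, level m' (corner i j x) else exists a : R[i], x = a *: 1.

Lemma level_linear m (a : R[i]) x y : level m x -> level m y -> level m (a *: x + y).
Proof.
elim: m x y => [x y [b ->] [c ->]|m IH x y hx hy i j].
  by exists (a * b + c); rewrite scalerA -scalerDl.
by rewrite corner_linear; apply: IH.
Qed.

Lemma level0 m : level m 0.
Proof. by elim: m => [|m IH i j]; [exists 0; rewrite scale0r|rewrite corner0]. Qed.

Lemma level_sum m I (s : seq I) (F : I -> A) :
  (forall l, level m (F l)) -> level m (\sum_(i <- s) F i).
Proof.
move=> hF; elim/big_ind: _ => [|x y hx hy|//]; first exact: level0.
by rewrite -[x]scale1r; exact: level_linear.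
Qed.

Lemma levelM m x y : level m x -> level m y -> level m (x * y).
Proof.
elim: m x y => [x y [b ->] [c ->]|m IH x y hx hy i j].
  by exists (b * c); rewrite -scalerAl mul1r scalerA.
by rewrite cornerM; apply: level_sum => l; apply: IH.
Qed.

Lemma level_star m x : level m x -> level m (star x).
Proof.
elim: m x => [x [b ->]|m IH x hx i j].
  by exists b^*; rewrite starZ star1.
by rewrite corner_star; apply: IH.
Qed.

Lemma level_scalar m (a : R[i]) : level m (a *: 1).
Proof.
elim: m => [|m IH i j]; first by exists a.
rewrite -[a *: 1]addr0 corner_linear corner0 addr0 corner1.
by case: (i == j); [exact: IH|rewrite scaler0; exact: level0].
Qed.

Lemma levelS m x : level m x -> level m.+1 x.
Proof.
elim: m x => [x [b ->]|m IH x hx i j]; first exact: level_scalar.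
exact: IH.
Qed.

Lemma level_mono m p x : (m <= p)%N -> level m x -> level p x.
Proof.
move=> /subnK <-; elim: (p - m)%N => // q IH hx; rewrite addSn; apply: levelS; exact: IH.
Qed.

Lemma level_shift m x : level m x -> level m.+1 (phi x).
Proof.
move=> hx i j; rewrite corner_shift; case: (i == j);
  rewrite ?mul1r ?mul0r//; exact: level0.
Qed.

Lemma level_unit m x i j : level m x -> level m.+1 (S i * x * star (S j)).
Proof.
move=> hx l p; rewrite corner_unit; case: (_ && _);
  rewrite ?mul1r ?mul0r//; exact: level0.
Qed.

(** As a matrix of corners, phi^(m+1)(y) is diagonal with all entries phi^m(y), which commute with
    the corners of x by induction. *)
Lemma level_comm m x y : level m x -> x * iter m phi y = iter m phi y * x.
Proof.
elim: m x y => [x y [b ->]|m IH x y hx]; first by rewrite -scalerAl -scalerAr mul1r mulr1.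
rewrite iterS; apply: corner_inj => i j; rewrite !cornerM.
rewrite (bigD1 j)//= big1 => [|l lj]; last first.
  by rewrite corner_shift (negbTE lj) mul0r mulr0.
rewrite [RHS](bigD1 i)//= [X in _ = _ + X]big1 => [|l li]; last first.
  by rewrite corner_shift eq_sym (negbTE li) !mul0r.
by rewrite !corner_shift !eqxx !mul1r !addr0 IH.
Qed.

(** Since P_i = (S_i S_j^* ) P_j (S_j S_i^* ) and x commutes with the image of phi^m, x phi^m(P_i)
    vanishes for every i; these products sum to x. *)
Lemma level_cancel m x j : level m x -> x * iter m phi (S j * star (S j)) = 0 -> x = 0.
Proof.
move=> hx x0; rewrite -[x]mulr1 -(iter_shift1 m) -cuntz_sum1 iter_shift_sum mulr_sumr.
apply: big1 => i _.
have -> : S i * star (S i) = (S i * star (S j)) * (S j * star (S j)) * (S j * star (S i)).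
  by rewrite -!mulrA !(mulrA (star (S j)) (S j)) cuntz_isometry !mul1r.
rewrite 2!iter_shiftM !mulrA (level_comm _ _ (S i * star (S j)) hx).
by rewrite -[_ * x * _]mulrA x0 mulr0 mul0r.
Qed.

Lemma word_cons m i (a : m.-tuple 'I_n) : word S [tuple of i :: a] = S i * word S a.
Proof. by rewrite /word big_cons. Qed.

Lemma word_nil (a : 0.-tuple 'I_n) : word S a = 1.
Proof. by rewrite /word tuple0 big_nil. Qed.

(** Taking a corner strips the first letter from both words of S_a S_b^*; conversely,
    [corner_expand] prepends one to each. *)
Lemma Fn_levelP m x : Fn S m x <-> level m x.
Proof.
split.
  move=> [p [c [v [hv ->]]]]; apply: level_sum => l.
  rewrite -[_ *: _]addr0; apply: level_linear; last exact: level0.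
  have [a [b ->]] := hv l; elim: m a b {hv} => [a b|m IH a b].
    by rewrite !word_nil star1 mulr1 -[1]scale1r; exact: level_scalar.
  case/tupleP: a => i a; case/tupleP: b => j b.
  by rewrite !word_cons starM mulrA -[S i * _ * _]mulrA; apply: level_unit.
elim: m x => [x [a ->]|m IH x hx].
  exists 1%N, (fun=> a), (fun=> 1); rewrite big_ord1; split => // _.
  by exists [tuple], [tuple]; rewrite !word_nil star1 mulr1.
rewrite [x]corner_expand.
elim/big_ind: _ => [||i _]; [exact: lspan0|exact: lspanD|].
elim/big_ind: _ => [||j _]; [exact: lspan0|exact: lspanD|].
have [p [c [v [hv ->]]]] := IH _ (hx i j).
exists p, c, (fun l => S i * v l * star (S j)); split.
  move=> l; have [a [b ->]] := hv l.
  exists [tuple of i :: a], [tuple of j :: b].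
  by rewrite !word_cons starM !mulrA.
rewrite mulr_sumr mulr_suml; apply: eq_bigr => l _.
by rewrite -scalerAr -scalerAl.
Qed.

End CuntzCorners.

(** * The diagonal subalgebra and its slices *)

Section Diagonal.
Context {R : realType} {A : cstarAlgType R} {n : nat} (S : 'I_n -> A).
Hypothesis hS : cuntz_algebra S.
Implicit Types (x y c d : A) (i j : 'I_n).
Local Notation phi := (cuntz_shift S).

Lemma Dn_subalgebra : cstar_subalgebra (Dn S).
Proof. exact: cstar_generatedP. Qed.

Lemma Dn_word m (a : m.-tuple 'I_n) : Dn S (word S a * star (word S a)).
Proof. by move=> B [_]; apply; exists m, a. Qed.

Lemma Dn0 : Dn S 0.
Proof. by have [_ D0 _ _ _] := Dn_subalgebra. Qed.

Lemma Dn_linear (a : R[i]) x y : Dn S x -> Dn S y -> Dn S (a *: x + y).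
Proof. by have [_ _ Dl _ _] := Dn_subalgebra; exact: Dl. Qed.

Lemma DnM x y : Dn S x -> Dn S y -> Dn S (x * y).
Proof. by have [_ _ _ DM _] := Dn_subalgebra; exact: DM. Qed.

Lemma Dn_scalar (a : R[i]) : Dn S (a *: 1).
Proof.
apply: (cstar_subalgebraZ _ Dn_subalgebra).
by have := @Dn_word 0 [tuple]; rewrite word_nil star1 mulr1.
Qed.

Lemma word_projection_cons m i (a : m.-tuple 'I_n) :
  word S [tuple of i :: a] * star (word S [tuple of i :: a]) =
  S i * (word S a * star (word S a)) * star (S i).
Proof. by rewrite word_cons starM !mulrA. Qed.

(** Equal first letters are stripped on both sides; distinct ones make both products zero. *)
Lemma word_projection_comm m p (a : m.-tuple 'I_n) (b : p.-tuple 'I_n) :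
  word S a * star (word S a) * (word S b * star (word S b)) =
  word S b * star (word S b) * (word S a * star (word S a)).
Proof.
elim: m p a b => [|m IH] [|p] a b; rewrite ?word_nil ?star1 ?mulr1 ?mul1r//.
case/tupleP: a => i a; case/tupleP: b => j b; rewrite !word_projection_cons.
move: (IH _ a b); move: (word S a * _) (word S b * _) => qa qb ab.
rewrite !mulrA -[_ * star (S i) * S j]mulrA -[_ * star (S j) * S i]mulrA.
rewrite !(cuntz_relation _ hS) [j == i]eq_sym.
have [->|_] := eqVneq i j; last by rewrite !mulr0 !mul0r.
rewrite !mulr1; congr (_ * _).
by rewrite -mulrA ab mulrA.
Qed.

Lemma Dn_comm x y : Dn S x -> Dn S y -> x * y = y * x.
Proof.
apply: cstar_generated_commutative.
  by move=> _ [m [a ->]]; exists m, a; rewrite starM starK.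
by move=> _ _ [m [a ->]] [p [b ->]]; exact: word_projection_comm.
Qed.

(** Conjugation by S_i is bounded and, as S_i is an isometry, multiplicative; so the set [B] is a
    C*-subalgebra containing the word projections. *)
Lemma Dn_unit i d : Dn S d -> Dn S (S i * d * star (S i)).
Proof.
pose B := [set d | Dn S (S i * d * star (S i))].
suff BP : cstar_subalgebra B.
  apply: (cstar_generated_min _ B BP) => _ [m [a ->]].
  by rewrite /B /= -word_projection_cons; exact: Dn_word.
have [Dc D0 Dl Dm Ds] := Dn_subalgebra; rewrite /B; split => /=.
- apply: (@closed_preimage _ _ (fun x => S i * x * star (S i))
    (cnorm (S i) * cnorm (S i))) => //.
    by move=> x y; rewrite mulrBr mulrBl.
  move=> x; rewrite (le_trans (cnormM _ _))// cnorm_star mulrAC ler_wpM2r ?cnorm_ge0//.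
  exact: cnormM.
- by rewrite mulr0 mul0r.
- by move=> c x y Bx By; rewrite mulrDr mulrDl -scalerAr -scalerAl; exact: Dl.
- move=> x y Bx By; have := Dm _ _ Bx By.
  by rewrite -!mulrA (mulrA (star (S i)) (S i)) (cuntz_isometry _ hS) mul1r.
- by move=> x Bx; have := Ds _ Bx; rewrite !starM starK mulrA.
Qed.

Lemma Dn_range i : Dn S (S i * star (S i)).
Proof. by have := Dn_unit i _ (Dn_scalar 1); rewrite scale1r mulr1. Qed.

Lemma Dn_sum I (s : seq I) (F : I -> A) :
  (forall l, Dn S (F l)) -> Dn S (\sum_(l <- s) F l).
Proof. exact: (cstar_subalgebra_sum _ Dn_subalgebra). Qed.

Lemma Dn_shift d : Dn S d -> Dn S (phi d).
Proof. by move=> Dd; apply: Dn_sum => i; exact: Dn_unit. Qed.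

Lemma Dn_iter_shift m d : Dn S d -> Dn S (iter m phi d).
Proof. by move=> Dd; elim: m => // m; exact: Dn_shift. Qed.

Lemma level_range m i : level S m.+1 (S i * star (S i)).
Proof.
by have := level_unit _ hS _ _ i i (level_scalar _ hS m 1); rewrite scale1r mulr1.
Qed.

(* The diagonal of a full matrix algebra is its own commutant. *)
Lemma level_comm_Dn m c : level S m c ->
  (forall d, Dn S d -> level S m d -> c * d = d * c) -> Dn S c.
Proof.
elim: m c => [c [a ->] _|m IH c lc hc]; first exact: Dn_scalar.
(* Commuting with the range projection of S_i kills the off-diagonal corners. *)
have off i j : i != j -> corner S i j c = 0.
  move=> ij; rewrite /corner; have := hc _ (Dn_range i) (level_range m i).
  move=> /(congr1 (fun x => star (S i) * x * S j)).
  rewrite /= !mulrA (cuntz_isometry _ hS) mul1r -[_ * star (S i) * S j]mulrA.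
  by rewrite (cuntz_orthogonal _ hS)// mulr0 => <-.
rewrite [c](corner_expand _ hS); apply: Dn_sum => i; apply: Dn_sum => j.
have [<-{j}|ij] := eqVneq i j; last by rewrite off// mulr0 mul0r; exact: Dn0.
apply: Dn_unit; apply: IH; first exact: lc.
(* Testing c against S_i d S_i^* makes its i-th diagonal corner commute with d. *)
move=> d Dd ld; have := hc _ (Dn_unit i _ Dd) (level_unit _ hS _ _ i i ld).
move=> /(congr1 (fun x => star (S i) * x * S i)).
rewrite /= !mulrA (cuntz_isometry _ hS) mul1r -!mulrA.
rewrite (cuntz_isometry _ hS) mulr1 /corner !mulrA.
by move=> ->.
Qed.

(** Multiplying the sum y by p_j = phi^m(P_j) isolates a_j p_j. A diagonal d of level m commutes
    with y and with p_j, so (a_j d - d a_j) p_j = 0; [level_cancel] removes p_j and [level_comm_Dn]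
    concludes. *)
Lemma Dn_slice m (a : 'I_n -> A) : (forall j, level S m (a j)) ->
  Dn S (\sum_j a j * iter m phi (S j * star (S j))) -> forall j, Dn S (a j).
Proof.
move=> la Da j; apply: (level_comm_Dn m) => // d Dd ld.
set y := \sum_(l < n) _ in Da.
pose p l := iter m phi (S l * star (S l)).
have pp l : y * p l = a l * p l.
  rewrite /y mulr_suml (bigD1 l)//= big1 => [|q ql]; rewrite -mulrA -(iter_shiftM _ hS).
    by rewrite addr0 !mulrA -[_ * _ * S l]mulrA (cuntz_isometry _ hS) mulr1.
  rewrite !mulrA -[_ * _ * S l]mulrA (cuntz_orthogonal _ hS)// mulr0 mul0r.
  by rewrite (iter_shift0 _ hS) mulr0.
apply/eqP; rewrite -subr_eq0; apply/eqP; apply: (level_cancel _ hS m _ j).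
  rewrite -[a j * d]scale1r addrC -scaleN1r; apply: level_linear => //.
    exact: (levelM _ hS).
  by rewrite scale1r; exact: (levelM _ hS).
have dp : d * p j = p j * d by exact: (level_comm _ hS).
rewrite -/(p j) mulrBl -!mulrA dp (mulrA (a j)) -!pp mulrA (Dn_comm _ _ Dd Da).
by rewrite -!mulrA dp subrr.
Qed.

Lemma Dn_slice_sum m (a : 'I_n -> A) : (forall j, Dn S (a j)) ->
  Dn S (\sum_j a j * iter m phi (S j * star (S j))).
Proof.
move=> Da; apply: Dn_sum => j; apply: DnM => //.
by apply: Dn_iter_shift; exact: Dn_range.
Qed.

End Diagonal.

(** * The twisted shift and the coefficient maps *)

Section TwistedShift.
Context {R : realType} {A : cstarAlgType R} {n : nat} (S : 'I_n -> A).
Hypothesis hS : cuntz_algebra S.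
Context (k : nat) (w : A) (E : 'I_n -> 'I_n -> A -> A).
Hypotheses (hk : (0 < k)%N) (hwF : Fn S k w) (hwU : unitary_elt w).
Hypothesis hE : coefficient_maps S k E.
Implicit Types (x y : A) (i j : 'I_n).
Local Notation phi := (cuntz_shift S).
Local Notation rproj i := (S i * star (S i)).

Definition twisted_shift x := w * phi x * star w.
Local Notation Phi := twisted_shift.

Lemma unitary_level : level S k w.
Proof. exact/(Fn_levelP _ hS). Qed.

Lemma twisted_shift_linear (a : R[i]) x y : Phi (a *: x + y) = a *: Phi x + Phi y.
Proof. by rewrite /Phi (shift_linear _ hS) mulrDr mulrDl -scalerAr -scalerAl. Qed.

Lemma twisted_shiftM x y : Phi (x * y) = Phi x * Phi y.
Proof.
rewrite /Phi (shiftM _ hS) -!mulrA; congr (_ * (_ * _)).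
by rewrite (mulrA (star w)) hwU.1 mul1r.
Qed.

Lemma iter_twisted_shift_linear s (a : R[i]) x y :
  iter s Phi (a *: x + y) = a *: iter s Phi x + iter s Phi y.
Proof. by elim: s => // s IH; rewrite !iterS IH twisted_shift_linear. Qed.

Lemma iter_twisted_shift0 s : iter s Phi 0 = 0.
Proof.
elim: s => // s IH; rewrite iterS IH /Phi -(iter_shift0 _ hS 1) /= (shift0 _ hS).
by rewrite (shift0 _ hS) mulr0 mul0r.
Qed.

Lemma iter_twisted_shiftM s x y : iter s Phi (x * y) = iter s Phi x * iter s Phi y.
Proof. by elim: s => // s IH; rewrite !iterS IH twisted_shiftM. Qed.

Lemma iter_twisted_shift_scalar s (a : R[i]) : iter s Phi (a *: 1) = a *: 1.
Proof.
elim: s => // s IH; rewrite iterS IH -[a *: 1]addr0 twisted_shift_linear.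
rewrite -[Phi 0]/(iter 1 Phi 0) iter_twisted_shift0 !addr0.
by rewrite /Phi (shift1 _ hS) mulr1 hwU.2.
Qed.

Lemma twisted_shift_level m x : (k <= m.+1)%N -> level S m x -> level S m.+1 (Phi x).
Proof.
move=> km lx; have lw := level_mono _ hS _ _ _ km unitary_level.
apply: (levelM _ hS); last exact: level_star.
by apply: (levelM _ hS) => //; exact: (level_shift _ hS).
Qed.

Lemma iter_twisted_shift_level s x :
  level S k.-1 x -> level S (k.-1 + s) (iter s Phi x).
Proof.
move=> lx; elim: s => [|s IH]; first by rewrite addn0.
by rewrite addnS iterS; apply: twisted_shift_level IH; rewrite -addSn prednK// leq_addr.
Qed.

(** At each step w has level at most that of the accumulated shift, so it commutes with the shifted
    element and cancels against its adjoint. *)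
Lemma iter_twisted_shift_shift s x :
  iter s Phi (iter k.-1 phi x) = iter (k.-1 + s) phi x.
Proof.
elim: s => [|s IH]; first by rewrite addn0.
rewrite iterS IH /Phi -iterS addnS.
have lw : level S (k.-1 + s).+1 w.
  apply: (level_mono _ hS _ _ _ _ unitary_level).
  by rewrite -addSn prednK// leq_addr.
by rewrite (level_comm _ hS _ _ _ lw) -mulrA hwU.2 mulr1.
Qed.

Lemma coefficient_level i j x : level S k x -> level S k.-1 (E i j x).
Proof.
move=> lx; apply/(Fn_levelP _ hS); case: hE => h _ _; apply: h.
exact/(Fn_levelP _ hS).
Qed.

(** The T_ij = phi^(k-1)(S_i S_j^* ) are matrix units commuting with the coefficients, so T_ii y
    T_jj = E_ij(y) T_ij. This is 0 for distinct i and j because y commutes with the diagonal element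
    T_ii. *)
Lemma coefficient_diagonal y : level S k y -> Dn S y ->
  y = \sum_j E j j y * iter k.-1 phi (rproj j).
Proof.
move=> ly Dy.
pose T i j := iter k.-1 phi (S i * star (S j)).
have yE : y = \sum_i \sum_j E i j y * T i j.
  by case: hE => _ _; apply; exact/(Fn_levelP _ hS).
have TT i j p q : T i j * T p q = (j == p)%:R * T i q.
  rewrite /T -(iter_shiftM _ hS) !mulrA -[S i * _ * _]mulrA (cuntz_relation _ hS).
  case: (j == p); rewrite ?mulr1 ?mul1r// mulr0 !mul0r; exact: (iter_shift0 _ hS).
have TE i j p q x : T i j * (E p q y * x) = E p q y * (T i j * x).
  rewrite !mulrA; congr (_ * _); apply/esym/(level_comm _ hS).
  exact: coefficient_level.
have row i j p : T i i * (\sum_q E p q y * T p q) * T j j =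
    E p j y * ((i == p)%:R * T i j).
  rewrite mulr_sumr mulr_suml (bigD1 j)//= big1 => [|q qj]; last first.
    by rewrite TE TT -!mulrA TT (negbTE qj) mul0r !mulr0.
  by rewrite addr0 TE TT -!mulrA TT eqxx mul1r.
have cut i j : T i i * y * T j j = E i j y * T i j.
  rewrite {1}yE mulr_sumr mulr_suml (eq_bigr _ (fun p _ => row i j p)).
  rewrite (bigD1 i)//= big1 => [|p pi]; first by rewrite eqxx mul1r addr0.
  by rewrite eq_sym (negbTE pi) mul0r mulr0.
rewrite {1}yE; apply: eq_bigr => i _.
rewrite (bigD1 i)//= big1 ?addr0// => j ji.
have DT : Dn S (T i i) by apply: (Dn_iter_shift _ hS); exact: (Dn_range _ hS).
rewrite -cut (Dn_comm _ hS _ _ DT Dy) -mulrA TT eq_sym (negbTE ji).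
by rewrite mul0r mulr0.
Qed.

Lemma twisted_orbit_expand s y : level S k y -> Dn S y ->
  iter s Phi y = \sum_j iter s Phi (E j j y) * iter (k.-1 + s) phi (rproj j).
Proof.
move=> ly Dy; rewrite {1}(coefficient_diagonal _ ly Dy).
have PD u v : iter s Phi (u + v) = iter s Phi u + iter s Phi v.
  by rewrite -[u]scale1r iter_twisted_shift_linear !scale1r.
rewrite (big_morph _ PD (iter_twisted_shift0 s)); apply: eq_bigr => j _.
by rewrite iter_twisted_shiftM iter_twisted_shift_shift.
Qed.

(* The reduction behind the construction of the spaces frakS: the orbit of y
   stays diagonal iff the shorter orbits of its coefficients do. *)
Lemma twisted_orbit_diagonal s y : level S k y -> Dn S y ->
  Dn S (iter s Phi y) <-> forall j, Dn S (iter s Phi (E j j y)).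
Proof.
move=> ly Dy; rewrite twisted_orbit_expand//; split.
  apply: (Dn_slice _ hS) => j; apply: iter_twisted_shift_level.
  exact: coefficient_level.
exact: (Dn_slice_sum _ hS).
Qed.

Lemma conj_level1 x : level S 1 x -> level S k (w * x * star w).
Proof.
move=> lx; apply: (levelM _ hS); last exact/level_star/unitary_level.
apply: (levelM _ hS); first exact: unitary_level.
exact: (level_mono _ hS _ _ _ _ lx).
Qed.

Lemma twisted_shift_levelk y : level S k.-1 y -> level S k (Phi y).
Proof.
by move=> ly; rewrite -{1}(prednK hk); apply: twisted_shift_level; rewrite ?prednK.
Qed.

Lemma Dn1_level x : Dnk S 1 x -> level S 1 x.
Proof. by move=> [_ Fx]; exact/(Fn_levelP _ hS). Qed.

Lemma frakS_level s : frakS S w E s `<=` level S k.-1.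
Proof.
have sub X : X `<=` level S k.-1 -> lspan X `<=` level S k.-1.
  by move=> XL; apply: lspan_min => //;
    [exact: (level0 _)|move=> a x y; exact: level_linear].
elim: s => [|[|s] IH].
- by apply: sub => _ ->; rewrite -[1]scale1r; exact: (level_scalar _ hS).
- apply: sub => _ [j [x Dx ->]]; apply: coefficient_level; apply: conj_level1.
  exact: Dn1_level.
move=> _ [x /IH lx [y yS ->]]; rewrite -[x]scale1r; apply: level_linear => //.
move: yS; apply: sub => _ [j [z /IH lz ->]]; apply: coefficient_level.
exact: twisted_shift_levelk.
Qed.

Lemma orbit_diagonal_lspan s X : (forall x, X x -> Dn S (iter s Phi x)) ->
  forall x, lspan X x -> Dn S (iter s Phi x).
Proof.
move=> XD; apply: (lspan_min _ [set x | Dn S (iter s Phi x)]) => //=.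
  by rewrite iter_twisted_shift0; exact: Dn0.
move=> a x y Dx Dy; rewrite iter_twisted_shift_linear; exact: Dn_linear.
Qed.

Lemma frakS_zero s : frakS S w E s 0.
Proof.
elim: s => [|[|s] IH]; [exact: lspan0|exact: lspan0|].
by exists 0; [exact: IH|exists 0; [exact: lspan0|rewrite addr0]].
Qed.

(** Once the spaces are stationary, this becomes invariance under the maps E_jj composed with
    Phi. *)
Lemma frakS_coefficient s j y : frakS S w E s.+1 y -> frakS S w E s.+2 (E j j (Phi y)).
Proof.
move=> hy; exists 0; first exact: frakS_zero.
exists (E j j (Phi y)); last by rewrite add0r.
by apply: sub_lspan; exists j, y.
Qed.

End TwistedShift.

(** * The endomorphism on shifts and on the diagonal *)

Section CuntzEndomorphism.
Context {R : realType} {A : cstarAlgType R} {n : nat} (S : 'I_n -> A).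
Hypothesis hS : cuntz_algebra S.
Context (w : A) (lam : {lrmorphism A -> A}).
Hypothesis hlam : cuntz_endomorphism S w lam.
Implicit Types (x y : A) (i j : 'I_n).
Local Notation phi := (cuntz_shift S).

Lemma cuntz_endomorphism_unit i j x :
  lam (S i * x * star (S j)) = w * (S i * lam x * star (S j)) * star w.
Proof. by case: hlam => ls lS; rewrite !rmorphM/= ls !lS starM !mulrA. Qed.

Lemma cuntz_endomorphism_iter_shift s x :
  lam (iter s phi x) = iter s (twisted_shift S w) (lam x).
Proof.
elim: s => // s IH; rewrite !iterS -IH /twisted_shift {1 3}/cuntz_shift.
rewrite rmorph_sum mulr_sumr mulr_suml; apply: eq_bigr => i _.
exact: cuntz_endomorphism_unit.
Qed.

(** The corners of x are scalars, which [lam] fixes. *)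
Lemma cuntz_endomorphism_level1 x : level S 1 x -> lam x = w * x * star w.
Proof.
move=> lx; rewrite [x in LHS](corner_expand _ hS) [x in RHS](corner_expand _ hS).
rewrite rmorph_sum mulr_sumr mulr_suml; apply: eq_bigr => i _.
rewrite rmorph_sum mulr_sumr mulr_suml; apply: eq_bigr => j _.
rewrite /= cuntz_endomorphism_unit; congr (w * (_ * _ * _) * _).
by have [a ->] := lx i j; rewrite linearZ/= rmorph1.
Qed.

Lemma cuntz_endomorphism_Dn :
    (forall s i, Dn S (lam (iter s phi (S i * star (S i))))) ->
  lam @` Dn S `<=` Dn S.
Proof.
move=> h _ [x Dx <-]; have [ls _] := hlam; move: x Dx.
apply: (cstar_generated_min _ (lam @^-1` Dn S)).
  apply: star_morphism_preimage => //; exact: Dn_subalgebra.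
move=> _ [m [a ->]] /=.
(* Peeling off the first letter leaves a shifted tail, so the induction must cover all shifts. *)
suff hs s : Dn S (lam (iter s phi (word S a * star (word S a)))) by exact: (hs 0%N).
elim: m a s => [a s|m IH a s].
  rewrite word_nil star1 mulr1 (iter_shift1 _ hS) rmorph1 -[1]scale1r.
  exact: Dn_scalar.
case/tupleP: a => i a; rewrite word_projection_cons.
have -> : S i * (word S a * star (word S a)) * star (S i) =
    S i * star (S i) * phi (word S a * star (word S a)).
  apply: (corner_inj _ hS) => p q; rewrite (corner_unit _ hS) (cornerM _ hS).
  rewrite (bigD1 q)//= big1 => [|l lq]; last first.
    by rewrite (corner_shift _ hS) (negbTE lq) mul0r mulr0.
  rewrite (corner_shift _ hS) eqxx mul1r addr0; congr (_ * _).
  by have := corner_unit _ hS p q i i 1; rewrite !mulr1 => ->.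
rewrite (iter_shiftM _ hS) rmorphM -iterSr; apply: DnM; [exact: h|exact: IH].
Qed.

End CuntzEndomorphism.

(** * Monotonicity of the spaces [frakS] *)

Section FrakS.
Context {R : realType} {A : cstarAlgType R} {n : nat} (S : 'I_n -> A).
Context (w : A) (E : 'I_n -> 'I_n -> A -> A).

Lemma frakSS s : frakS S w E s.+2 =
  addset (frakS S w E s.+1)
    (lspan [set y | exists j, exists2 x, frakS S w E s.+1 x &
                    y = E j j (twisted_shift S w x)]).
Proof. by []. Qed.

Lemma frakS_leS s : frakS S w E s.+1 `<=` frakS S w E s.+2.
Proof.
by move=> x hx; exists x => //; exists 0; [exact: lspan0|rewrite addr0].
Qed.

Lemma frakS1_le s : (0 < s)%N -> frakS S w E 1 `<=` frakS S w E s.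
Proof.
case: s => // s _; elim: s => // s IH x /IH; exact: frakS_leS.
Qed.

End FrakS.

(** * Propagation of diagonality through stabilization *)

Theorem theorem4p1 (R : realType) (A : cstarAlgType R) (n : nat)
    (hn : (2 <= n)%N) (S : 'I_n -> A) (hS : cuntz_algebra S)
    (k : nat) (hk : (0 < k)%N)
    (w : A) (hwF : Fn S k w) (hwU : unitary_elt w)
    (lam : {lrmorphism A -> A}) (hlam : cuntz_endomorphism S w lam)
    (E : 'I_n -> 'I_n -> A -> A) (hE : coefficient_maps S k E)
    (r : nat) (hr : stabilization_index S w E r) :
  (lam @` Dn S `<=` Dn S) <-> (lam @` Dnk S r `<=` Dn S).
Proof.
split=> [H _ [x [Dx _] <-]|H]; first by apply: H; exists x.
have [r0 rE _] := hr.
pose orbit_Dn t y := Dn S (iter t (twisted_shift S w) y).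
have step := twisted_orbit_diagonal _ hS _ _ _ hk hwF hwU hE.
(* The hypothesis on D_n^r enters here: for t < r, phi^t maps D_n^1 into D_n^(t+1), which lies in
   D_n^r. *)
have short t x : (t < r)%N -> Dnk S 1 x -> orbit_Dn t (w * x * star w).
  move=> tr [Dx /(Fn_levelP _ hS) lx].
  rewrite /orbit_Dn -(cuntz_endomorphism_level1 _ hS _ _ hlam)//.
  rewrite -(cuntz_endomorphism_iter_shift _ _ _ hlam); apply: H.
  exists (iter t (cuntz_shift S) x) => //; split; first exact: Dn_iter_shift.
  apply/(Fn_levelP _ hS); apply: (level_mono _ hS _ _ _ tr).
  by elim: t {tr} => // t IH; rewrite iterS; exact: level_shift.
have gen t x j : Dnk S 1 x -> orbit_Dn t (w * x * star w) ->
    orbit_Dn t (E j j (w * x * star w)).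
  move=> D1x Dt; have lx := conj_level1 _ hS _ _ hk hwF _ (Dn1_level _ hS _ D1x).
  exact: (step t _ lx (short 0%N x r0 D1x)).1.
(* Each coefficient step trades one index of [frakS] for one more power of Phi, so the sum of the
   two indices is preserved down to s = 0, where [short] applies. *)
have frakS_orbit s t y : frakS S w E s.+1 y -> (t.+1 + s.+1 <= r)%N -> orbit_Dn t.+1 y.
  elim: s t y => [|s IH] t y.
    move=> yS tr; apply: (orbit_diagonal_lspan _ hS _ _ _ _ _ yS) => _ [j [x D1x ->]].
    by apply: gen => //; apply: short => //; rewrite -addn1.
  rewrite frakSS => -[u uS [v vS ->]] tr.
  rewrite /orbit_Dn -[u]scale1r (iter_twisted_shift_linear _ hS); apply: Dn_linear.
    by apply: IH => //; apply: leq_trans tr; rewrite leq_add2l.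
  apply: (orbit_diagonal_lspan _ hS _ _ _ _ _ vS) => _ [j [x xS ->]].
  have lx := twisted_shift_levelk _ hS _ _ hk hwF _
    (frakS_level _ hS _ _ _ hk hwF hE _ _ xS).
  have Dx : Dn S (twisted_shift S w x).
    by apply: (IH 0%N x xS); apply: leq_trans tr; exact: leq_add.
  apply: (step t.+1 _ lx Dx).1; rewrite -iterSr; apply: (IH t.+1 x xS).
  by rewrite addSnnS.
have stable t y : frakS S w E r y -> orbit_Dn t.+1 y.
  rewrite rE; case: r rE r0 frakS_orbit {H hr short gen} => [//|[|q]] rE _ frakS_orbit.
    (* Case r = 1: S_0 consists of scalars, which Phi fixes. *)
    apply: (orbit_diagonal_lspan _ hS) => _ ->.
    by rewrite -[1]scale1r (iter_twisted_shift_scalar _ hS _ hwU); exact: Dn_scalar.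
  (* Case r = q + 2: the coefficients of Phi(y) stay in S_(q+1), so the power of Phi can grow
     indefinitely. *)
  rewrite succnK in rE *; elim: t y => [|t IH] y yS; first exact: (frakS_orbit q).
  have lx := twisted_shift_levelk _ hS _ _ hk hwF _
    (frakS_level _ hS _ _ _ hk hwF hE _ _ yS).
  rewrite /orbit_Dn iterSr; apply: (step t.+1 _ lx _).2.
    exact: (frakS_orbit q 0%N).
  by move=> j; apply: IH; have := frakS_coefficient _ _ _ _ j _ yS; rewrite rE.
apply: (cuntz_endomorphism_Dn _ hS _ _ hlam) => t i.
have D1 : Dnk S 1 (S i * star (S i)).
  by split; [exact: Dn_range|apply/(Fn_levelP _ hS); exact: level_range].
have l1 := Dn1_level _ hS _ D1.
rewrite (cuntz_endomorphism_iter_shift _ _ _ hlam).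
rewrite (cuntz_endomorphism_level1 _ hS _ _ hlam)//.
case: t => [|t]; first exact: (short 0%N).
have lx := conj_level1 _ hS _ _ hk hwF _ l1.
(* The coefficients of w P_i w^* lie in S_1, hence in S_r, where [stable] covers every positive
   power. *)
apply: (step t.+1 _ lx (short 0%N _ r0 D1)).2 => j; apply: stable.
by apply: frakS1_le => //; apply: sub_lspan; exists j, (S i * star (S i)).
Qed.
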